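(* Let $T$ be a set of graded formulas and let $\langle q,\varphi\rangle$ be a graded formula. Then $T\vdash_{\mathrm{GRPL}}\langle q,\varphi\rangle$ if and only if $\{\overline{r}\to\psi \mid \langle r,\psi\rangle\in T\}\vdash_{\mathrm{RPL}}\overline{q}\to\varphi$.
   Context: Language. Formulas are built from propositional variables and a constant $\overline{q}$ for each rational $q\in[0,1]$, using the basic connectives $\neg$ (unary) and $\to$ (binary); call this language $\mathcal{L}(\mathrm{RPL})$. Abbreviations: $\alpha\oplus\beta$ is $\neg\alpha\to\beta$; $\alpha\odot\beta$ is $\neg(\neg\alpha\oplus\neg\beta)$; $\alpha\wedge\beta$ is $\alpha\odot(\alpha\to\beta)$; $\alpha\equiv\beta$ is $(\alpha\to\beta)\wedge(\beta\to\alpha)$; $1$ is $p_0\to p_0$ for a fixed variable $p_0$, and $0$ is $\neg 1$. Operations on rationals in $[0,1]$: $q\to^{Ł}r=\min(1,1-q+r)$, $\neg^{Ł}q=1-q$, $q\odot^{Ł}r=\max(0,q+r-1)$. Łukasiewicz axiom schemata (instances are taken over $\mathcal{L}(\mathrm{RPL})$): (A1) $\varphi\to(\psi\to\varphi)$; (A2) $(\varphi\to\psi)\to((\psi\to\chi)\to(\varphi\to\chi))$; (A3) $((\varphi\to\psi)\to\psi)\to((\psi\to\varphi)\to\varphi)$; (A4) $(\neg\varphi\to\neg\psi)\to(\psi\to\varphi)$. Rational Pavelka logic RPL. Axioms: all instances of (A1)–(A4) and the bookkeeping axioms $(\overline{q}\to\overline{r})\equiv\overline{q\to^{Ł}r}$,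 $\neg\overline{q}\equiv\overline{\neg^{Ł}q}$, $\overline{1}\equiv 1$, $\overline{0}\equiv 0$, for all rationals $q,r\in[0,1]$. The only rule is modus ponens: from $\varphi$ and $\varphi\to\psi$ infer $\psi$. For a set $S\cup\{\varphi\}$ of formulas, $S\vdash_{\mathrm{RPL}}\varphi$ means there is a finite sequence of formulas ending in $\varphi$, each of which is an axiom, an element of $S$, or follows from earlier elements by modus ponens. Graded Rational Pavelka logic GRPL. A graded formula is a pair $\langle r,\varphi\rangle$ with $r\in[0,1]$ rational (the grade) and $\varphi$ a formula of $\mathcal{L}(\mathrm{RPL})$. Axioms of GRPL: (A) $\langle 1,\alpha\rangle$ for each instance $\alpha$ of (A1)–(A4); (B) $\langle q,\overline{q}\rangle$ for each rational $q\in[0,1]$; (C) $\langle 1,\neg\overline{q}\equiv\overline{\neg^{Ł}q}\rangle$ and $\langle 1,(\overline{q}\to\overline{r})\equiv\overline{q\to^{Ł}r}\rangle$ for all rationals $q,r\in[0,1]$; (D) $\langle 0,\varphi\rangle$ for every other formula $\varphi$ of $\mathcal{L}(\mathrm{RPL})$. Rules, for all rationals $q,r\in[0,1]$: graded modus ponens: from $\langle q,\varphi\rangle$ and $\langle r,\varphi\to\psi\rangle$ infer $\langle q\odot^{Ł}r,\psi\rangle$; lifting: from $\langle q,\varphi\rangle$ infer $\langle r\to^{Ł}q,\overline{r}\to\varphi\rangle$. For a set $T$ of graded formulas, a GRPL-proof from $T$ is a finite sequence of graded formulas each of which is an axiom of GRPL, an element of $T$, or follows from earlier elements by one of the two rules;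 $T\vdash_{\mathrm{GRPL}}\langle q,\varphi\rangle$ means that $\langle q,\varphi\rangle$ is the last element of some GRPL-proof from $T$. *)

(* Defs.v *)
From Stdlib Require List.
From mathcomp Require Import all_boot all_order all_algebra.
From mathcomp Require Import classical_sets.
Set Implicit Arguments.
Unset Strict Implicit.
Unset Printing Implicit Defensive.
Import Order.TTheory GRing.Theory Num.Theory.
Local Open Scope ring_scope.

Definition grade : Type := {q : rat | 0 <= q <= 1}.

Fact luk_one_subproof : 0 <= (1 : rat) <= 1.
Proof. by []. Qed.

Fact luk_zero_subproof : 0 <= (0 : rat) <= 1.
Proof. by []. Qed.

Fact luk_neg_subproof (q : grade) : 0 <= 1 - val q <= 1.
Proof.
by case: q => q /= /andP[q0 q1]; rewrite subr_ge0 q1 gerBl.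
Qed.

Fact luk_imp_subproof (q r : grade) :
  0 <= Num.min 1 (1 - val q + val r) <= 1.
Proof.
case: q r => [q /= /andP[q0 q1]] [r /= /andP[r0 r1]].
by rewrite le_min ler01 ge_min lexx addr_ge0 // subr_ge0.
Qed.

Fact luk_conj_subproof (q r : grade) :
  0 <= Num.max 0 (val q + val r - 1) <= 1.
Proof.
case: q r => [q /= /andP[q0 q1]] [r /= /andP[r0 r1]].
by rewrite le_max lexx ge_max ler01 /= lerBlDr lerD.
Qed.

Definition luk_one : grade := exist _ 1 luk_one_subproof.
Definition luk_zero : grade := exist _ 0 luk_zero_subproof.
Definition luk_neg (q : grade) : grade :=
  exist _ (1 - val q) (luk_neg_subproof q).
Definition luk_imp (q r : grade) : grade :=
  exist _ (Num.min 1 (1 - val q + val r)) (luk_imp_subproof q r).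
Definition luk_conj (q r : grade) : grade :=
  exist _ (Num.max 0 (val q + val r - 1)) (luk_conj_subproof q r).

Inductive formula : Type :=
| Var of nat
| Const of grade
| Neg of formula
| Imp of formula & formula.

Declare Scope formula_scope.
Delimit Scope formula_scope with F.
Bind Scope formula_scope with formula.
Notation "a ~> b" := (Imp a b)
  (at level 90, right associativity) : formula_scope.
Local Open Scope formula_scope.

Definition Oplus (a b : formula) : formula := Neg a ~> b.
Definition Odot (a b : formula) : formula := Neg (Oplus (Neg a) (Neg b)).
Definition And (a b : formula) : formula := Odot a (a ~> b).
Definition Equiv (a b : formula) : formula := And (a ~> b) (b ~> a).
(* These are the defined formulas 1 and 0, which are syntactically distinct
   from the truth constants [Const luk_one] and [Const luk_zero]. *)
Definition One : formula := Var 0 ~> Var 0.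
Definition Zero : formula := Neg One.

Inductive luk_axiom : formula -> Prop :=
| LukA1 a b : luk_axiom (a ~> (b ~> a))
| LukA2 a b c : luk_axiom ((a ~> b) ~> ((b ~> c) ~> (a ~> c)))
| LukA3 a b : luk_axiom (((a ~> b) ~> b) ~> ((b ~> a) ~> a))
| LukA4 a b : luk_axiom ((Neg a ~> Neg b) ~> (b ~> a)).

Inductive bookkeeping : formula -> Prop :=
| BookNeg q : bookkeeping (Equiv (Neg (Const q)) (Const (luk_neg q)))
| BookImp q r :
    bookkeeping (Equiv (Const q ~> Const r) (Const (luk_imp q r))).

Inductive rpl_axiom : formula -> Prop :=
| RPLLuk a of luk_axiom a : rpl_axiom a
| RPLBook a of bookkeeping a : rpl_axiom a
| RPLOne : rpl_axiom (Equiv (Const luk_one) One)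
| RPLZero : rpl_axiom (Equiv (Const luk_zero) Zero).

(* [ok l x] says that [x] is justified when [l] lists the earlier entries. *)
Definition is_proof (X : Type) (ok : seq X -> X -> Prop) (s : seq X) : Prop :=
  forall l x l', s = l ++ x :: l' -> ok l x.

Definition rpl_step (S : set formula) (l : seq formula) (a : formula) : Prop :=
  [\/ rpl_axiom a,
      S a
    | exists b, List.In b l /\ List.In (b ~> a) l].

Definition rpl_proves (S : set formula) (a : formula) : Prop :=
  exists l, is_proof (rpl_step S) (rcons l a).

Definition graded_formula : Type := (grade * formula)%type.

Inductive grpl_axiom : graded_formula -> Prop :=
| GRPLLuk a of luk_axiom a : grpl_axiom (luk_one, a)
| GRPLConst q : grpl_axiom (q, Const q)
| GRPLBook a of bookkeeping a : grpl_axiom (luk_one, a)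
| GRPLOther a of ~ luk_axiom a & ~ (exists q, a = Const q) & ~ bookkeeping a :
    grpl_axiom (luk_zero, a).

Inductive graded_mp :
    graded_formula -> graded_formula -> graded_formula -> Prop :=
| GradedMP q r a b : graded_mp (q, a) (r, a ~> b) (luk_conj q r, b).

Inductive lifting : graded_formula -> graded_formula -> Prop :=
| Lifting q r a : lifting (q, a) (luk_imp r q, Const r ~> a).

Definition grpl_step (T : set graded_formula) (l : seq graded_formula)
    (x : graded_formula) : Prop :=
  [\/ grpl_axiom x,
      T x,
      exists y z, [/\ List.In y l, List.In z l & graded_mp y z x]
    | exists y, List.In y l /\ lifting y x].

Definition grpl_proves (T : set graded_formula) (x : graded_formula) : Prop :=
  exists l, is_proof (grpl_step T) (rcons l x).

(* Main.v *)
Require Import Defs.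
From mathcomp Require Import all_boot all_order all_algebra.
From mathcomp Require Import classical_sets.
From mathcomp Require Import lra.
Set Implicit Arguments.
Unset Strict Implicit.
Unset Printing Implicit Defensive.
Local Open Scope classical_set_scope.

(* The formulas provable in RPL from S, and the formulas provable with grade 1
   in GRPL from T, both form sets containing (A1)-(A4) and closed under modus
   ponens, so each allows all of Lukasiewicz reasoning.  A GRPL-proof becomes an
   RPL-proof by reading each entry <r, psi> as Const r ~> psi; conversely an
   RPL-proof becomes a GRPL-proof by giving each entry grade 1, where lifting by
   r turns <r, psi> into <1, Const r ~> psi>.  Graded modus ponens with the axiom
   <q, Const q> finally turns <1, Const q ~> phi> into <q, phi>. *)

(** * Proof sequences for an arbitrary step relation *)

Section Proofs.

Variables (X : Type) (ok : seq X -> X -> Prop).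

Lemma is_proof_rcons l x :
  is_proof ok (rcons l x) <-> is_proof ok l /\ ok l x.
Proof.
split=> [pr|[pr okx] l1 y l2].
  split=> [l1 y l2 def_l|]; last by apply: (pr l x [::]); rewrite cats1.
  by apply: (pr l1 y (rcons l2 x)); rewrite def_l rcons_cat.
case/lastP: l2 => [|l2 z].
  by rewrite cats1 => /rcons_inj[<- <-].
by rewrite -rcons_cons -rcons_cat => /rcons_inj[/pr].
Qed.

Lemma is_proof_ind (P : X -> Prop) :
  (forall l x, (forall y, List.In y l -> P y) -> ok l x -> P x) ->
  forall l x, is_proof ok (rcons l x) -> P x.
Proof.
move=> stepP.
(* A step may cite any earlier entry, so the induction has to carry [P] for all entries and not only
   for the last. *)
suff allP l : is_proof ok l -> forall y, List.In y l -> P y.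
  by move=> l x /allP; apply; rewrite -cats1; apply/List.in_app_iff; right; left.
elim/last_ind: l => [_ y []|l x IHl] /is_proof_rcons[/IHl Pl okx] y.
rewrite -cats1 => /List.in_app_iff[/Pl //|[<-|[]]].
exact: stepP okx.
Qed.

Hypothesis ok_incl : forall l l' x, List.incl l l' -> ok l x -> ok l' x.

(** Putting [l] in front only enlarges the list of earlier entries, so [ok_incl] keeps every step of
    [l'] justified. *)
Lemma is_proof_cat l l' :
  is_proof ok l -> is_proof ok l' -> is_proof ok (l ++ l').
Proof.
move=> prl; elim/last_ind: l' => [|l' x IHl']; first by rewrite cats0.
case/is_proof_rcons=> /IHl' prll' okx; rewrite -rcons_cat.
apply/is_proof_rcons; split=> //; apply: ok_incl okx => y yl'.
by apply/List.in_app_iff; right.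
Qed.

(** Separate proofs of the premises are concatenated into one. From here on provability is used only
    through its closure under steps and [is_proof_ind]. *)
Lemma proves_step l x :
  (forall y, List.In y l -> exists s, is_proof ok (rcons s y)) ->
  ok l x -> exists s, is_proof ok (rcons s x).
Proof.
move=> prl okx.
have [s [prs sub_l]] : exists s, is_proof ok s /\ List.incl l s.
  elim: l prl {okx} => [_|y l IHl prl].
    by exists [::]; split=> [[]|y []].
  have [|s [prs sub_l]] := IHl; first by move=> z lz; apply: prl; right.
  have [t prt] := prl y (or_introl erefl).
  exists (s ++ rcons t y); split; first exact: is_proof_cat.
  move=> z [<-|/sub_l sz]; apply/List.in_app_iff; last by left.
  by right; rewrite -cats1; apply/List.in_app_iff; right; left.
exists s; apply/is_proof_rcons; split=> //; exact: ok_incl okx.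
Qed.

End Proofs.

(** * Derivations from (A1)-(A4) *)

Definition luk_theory (P : formula -> Prop) : Prop :=
  (forall a, luk_axiom a -> P a) /\ (forall a b, P (a ~> b)%F -> P a -> P b).

Section Lukasiewicz.

Local Open Scope formula_scope.

Variable P : formula -> Prop.
Hypothesis thP : luk_theory P.

Lemma luk_mp a b : P (a ~> b) -> P a -> P b.
Proof. by case: thP => _; apply. Qed.

Lemma luk_A1 a b : P (a ~> (b ~> a)).
Proof. by case: thP => + _; apply; constructor. Qed.

Lemma luk_A2 a b c : P ((a ~> b) ~> ((b ~> c) ~> (a ~> c))).
Proof. by case: thP => + _; apply; constructor. Qed.

Lemma luk_A3 a b : P (((a ~> b) ~> b) ~> ((b ~> a) ~> a)).
Proof. by case: thP => + _; apply; constructor. Qed.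

Lemma luk_A4 a b : P ((Neg a ~> Neg b) ~> (b ~> a)).
Proof. by case: thP => + _; apply; constructor. Qed.

Lemma luk_weaken a b : P a -> P (b ~> a).
Proof. exact/luk_mp/luk_A1. Qed.

Lemma luk_trans b a c : P (a ~> b) -> P (b ~> c) -> P (a ~> c).
Proof. by move=> Pab; apply: luk_mp; apply: luk_mp Pab; apply: luk_A2. Qed.

(** (A1) gives [a ~> ((b ~> a) ~> a)], and (A3) swaps the roles of [a] and [b]. Exchange of premises
    rests on this. *)
Lemma luk_apply a b : P (a ~> ((a ~> b) ~> b)).
Proof. exact: luk_trans (luk_A1 a (b ~> a)) (luk_A3 b a). Qed.

Lemma luk_exchange a b c : P (a ~> (b ~> c)) -> P (b ~> (a ~> c)).
Proof.
move=> Pabc; apply: luk_trans (luk_apply b c) _.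
exact: luk_mp (luk_A2 _ _ _) Pabc.
Qed.

Lemma luk_id a : P (a ~> a).
Proof.
exact: luk_mp (luk_exchange (luk_A1 a (a ~> (a ~> a)))) (luk_A1 a a).
Qed.

Lemma luk_prefix a b c : P (b ~> c) -> P ((a ~> b) ~> (a ~> c)).
Proof. exact/luk_mp/luk_exchange/luk_A2. Qed.

Lemma luk_absurd a b : P (Neg a ~> (a ~> b)).
Proof. exact: luk_trans (luk_A1 _ _) (luk_A4 _ _). Qed.

Lemma luk_dneg_elim a : P (Neg (Neg a) ~> a).
Proof.
(* The provable [a ~> a] serves as an auxiliary premise [t]: [Neg (Neg a)] yields [Neg a ~> Neg t],
   hence [t ~> a] by (A4). *)
apply: luk_mp (luk_id a); apply: luk_exchange.
exact: luk_trans (luk_absurd _ _) (luk_A4 _ _).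
Qed.

Lemma luk_dneg_intro a : P (a ~> Neg (Neg a)).
Proof. exact/(luk_mp (luk_A4 _ _))/luk_dneg_elim. Qed.

Lemma luk_contra_imp a b : P ((a ~> b) ~> (Neg b ~> Neg a)).
Proof.
apply: luk_trans (luk_A4 _ _).
apply: luk_trans (luk_prefix _ (luk_dneg_intro b)).
exact: luk_mp (luk_A2 _ _ _) (luk_dneg_elim a).
Qed.

Lemma luk_contra a b : P (a ~> b) -> P (Neg b ~> Neg a).
Proof. exact/luk_mp/luk_contra_imp. Qed.

Lemma luk_contraNl a b : P (Neg a ~> b) -> P (Neg b ~> a).
Proof. by move=> /luk_contra/luk_trans; apply; apply: luk_dneg_elim. Qed.

Lemma luk_Odot_intro a b : P a -> P b -> P (Odot a b).
Proof.
move=> Pa Pb; apply: luk_mp (luk_mp (luk_dneg_intro _) Pb); apply: luk_contra.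
exact: luk_mp (luk_apply _ _) (luk_mp (luk_dneg_intro _) Pa).
Qed.

(** [Odot a b] unfolds to the negation of [Neg (Neg a) ~> Neg b], an implication that follows from
    [Neg a] and also from [Neg b]. *)
Lemma luk_Odot_elim a b : P (Odot a b) -> P a /\ P b.
Proof.
move=> Pab; split; apply: luk_mp Pab; apply: luk_contraNl; last exact: luk_A1.
exact: luk_trans (luk_dneg_intro _) (luk_absurd _ _).
Qed.

Lemma luk_And a b : P (And a b) <-> P a /\ P b.
Proof.
split=> [/luk_Odot_elim[Pa Pab]|[Pa Pb]].
  by split=> //; apply: luk_mp Pa.
by apply: luk_Odot_intro => //; apply: luk_weaken.
Qed.

Lemma luk_Equiv a b : P (Equiv a b) <-> P (a ~> b) /\ P (b ~> a).
Proof. exact: luk_And. Qed.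

(** [Neg (a ~> Neg b)] is the strong conjunction up to double negation. Contraposition reduces the
    claim to [a ~> (b ~> d)], obtained by chaining the first two hypotheses. With truth constants
    for [a], [b] and [e] this is graded modus ponens inside RPL. *)
Lemma luk_Odot_imp a b c d e :
  P (a ~> c) -> P (b ~> (c ~> d)) -> P (e ~> Neg (a ~> Neg b)) -> P (e ~> d).
Proof.
move=> Pac Pbcd /luk_trans; apply; apply: luk_contraNl; apply: luk_exchange.
apply: (@luk_trans (b ~> d)); last exact: luk_contra_imp.
apply: luk_exchange; apply: luk_trans Pbcd _.
exact: luk_mp (luk_A2 _ _ _) Pac.
Qed.

(** * Bookkeeping for truth constants *)

Hypothesis bookP : forall a, bookkeeping a -> P a.

Lemma book_Neg q :
  P (Neg (Const q) ~> Const (luk_neg q)) /\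
  P (Const (luk_neg q) ~> Neg (Const q)).
Proof. exact/luk_Equiv/bookP/BookNeg. Qed.

Lemma book_Imp q r :
  P ((Const q ~> Const r) ~> Const (luk_imp q r)) /\
  P (Const (luk_imp q r) ~> (Const q ~> Const r)).
Proof. exact/luk_Equiv/bookP/BookImp. Qed.

(** Bookkeeping axioms speak only of negation and implication, so conjunction of grades is reduced
    to these. *)
Lemma luk_conjE q r : luk_conj q r = luk_neg (luk_imp q (luk_neg r)).
Proof.
apply: val_inj => /=.
set x := val q; set y := val r.
by rewrite /Num.max /Num.min; case: ifP; case: ifP; lra.
Qed.

Lemma book_conj q r :
  P (Const (luk_conj q r) ~> Neg (Const q ~> Neg (Const r))).
Proof.
rewrite luk_conjE; apply: luk_trans (proj2 (book_Neg _)) _.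
apply/luk_contra/luk_trans/(proj1 (book_Imp _ _)).
exact/luk_prefix/(proj1 (book_Neg _)).
Qed.

End Lukasiewicz.

(** * GRPL axioms and rules simulated in RPL *)

Section RPL.

Local Open Scope formula_scope.

Variable S : set formula.

Lemma rpl_step_incl l l' a :
  List.incl l l' -> rpl_step S l a -> rpl_step S l' a.
Proof.
move=> sub_l [axa|Sa|[b [lb lba]]]; [exact: Or31|exact: Or32|apply: Or33].
by exists b; split; apply: sub_l.
Qed.

Lemma rpl_proves_axiom a : rpl_axiom a -> rpl_proves S a.
Proof.
by move=> axa; apply: (proves_step rpl_step_incl (l := [::])) => //; apply: Or31.
Qed.

Lemma rpl_proves_hyp a : S a -> rpl_proves S a.
Proof.
by move=> Sa; apply: (proves_step rpl_step_incl (l := [::])) => //; apply: Or32.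
Qed.

Lemma rpl_luk_theory : luk_theory (rpl_proves S).
Proof.
split=> [a axa|a b Pab Pa]; first exact/rpl_proves_axiom/RPLLuk.
apply: (proves_step rpl_step_incl (l := [:: a ~> b; a])).
  by move=> c [<-|[<-|[]]].
by apply: Or33; exists a; split; [right; left|left].
Qed.

Lemma rpl_bookkeeping a : bookkeeping a -> rpl_proves S a.
Proof. by move/RPLBook/rpl_proves_axiom. Qed.

(** Ex falso, which takes care of the axioms (D): the constant implies [Neg One], and [One] is
    provable. *)
Lemma rpl_Zero a : rpl_proves S (Const luk_zero ~> a).
Proof.
have th := rpl_luk_theory.
have [zero _] := proj1 (luk_Equiv th _ _) (rpl_proves_axiom RPLZero).
apply: (luk_trans th zero); apply: (luk_contraNl th).
exact/(luk_weaken th)/(luk_id th).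
Qed.

Lemma rpl_graded_mp q r a b :
  rpl_proves S (Const q ~> a) -> rpl_proves S (Const r ~> (a ~> b)) ->
  rpl_proves S (Const (luk_conj q r) ~> b).
Proof.
have th := rpl_luk_theory => Pa Pab; apply: (luk_Odot_imp th Pa Pab).
exact: (book_conj th rpl_bookkeeping).
Qed.

Lemma rpl_lifting q r a :
  rpl_proves S (Const q ~> a) ->
  rpl_proves S (Const (luk_imp r q) ~> (Const r ~> a)).
Proof.
have th := rpl_luk_theory => Pa; apply: (luk_trans th) (luk_prefix th _ Pa).
exact: proj2 (book_Imp th rpl_bookkeeping _ _).
Qed.

End RPL.

(** * RPL axioms and modus ponens at grade 1 in GRPL *)

Section GRPL.

Local Open Scope formula_scope.

Variable T : set graded_formula.

Lemma grpl_step_incl l l' x :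
  List.incl l l' -> grpl_step T l x -> grpl_step T l' x.
Proof.
move=> sub_l [axx|Tx|[y [z [ly lz mpx]]]|[y [ly liftx]]].
- exact: Or41.
- exact: Or42.
- by apply: Or43; exists y, z; split=> //; apply: sub_l.
- by apply: Or44; exists y; split=> //; apply: sub_l.
Qed.

Lemma grpl_proves_axiom x : grpl_axiom x -> grpl_proves T x.
Proof.
by move=> axx; apply: (proves_step grpl_step_incl (l := [::])) => //; apply: Or41.
Qed.

Lemma grpl_proves_hyp x : T x -> grpl_proves T x.
Proof.
by move=> Tx; apply: (proves_step grpl_step_incl (l := [::])) => //; apply: Or42.
Qed.

Lemma grpl_proves_mp q r a b :
  grpl_proves T (q, a) -> grpl_proves T (r, a ~> b) ->
  grpl_proves T (luk_conj q r, b).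
Proof.
move=> Pa Pab.
apply: (proves_step grpl_step_incl (l := [:: (q, a); (r, a ~> b)])).
  by move=> x [<-|[<-|[]]].
apply: Or43; exists (q, a), (r, a ~> b).
by split; [left|right; left|exact: GradedMP].
Qed.

Lemma grpl_proves_lifting q r a :
  grpl_proves T (q, a) -> grpl_proves T (luk_imp r q, Const r ~> a).
Proof.
move=> Pa; apply: (proves_step grpl_step_incl (l := [:: (q, a)])).
  by move=> x [<-|[]].
by apply: Or44; exists (q, a); split; [left|exact: Lifting].
Qed.

Lemma luk_conjq1 q : luk_conj q luk_one = q.
Proof.
apply: val_inj; case: q => q /= /andP[q0 q1].
by rewrite /Num.max; case: ifP; lra.
Qed.

Lemma luk_impqq q : luk_imp q q = luk_one.
Proof. by apply: val_inj => /=; rewrite /Num.min; case: ifP; lra. Qed.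

Lemma luk_neg1 : luk_neg luk_one = luk_zero.
Proof. exact: val_inj. Qed.

Lemma grpl_luk_theory : luk_theory (fun a => grpl_proves T (luk_one, a)).
Proof.
split=> [a axa|a b Pab Pa]; first exact/grpl_proves_axiom/GRPLLuk.
by rewrite -(luk_conjq1 luk_one); apply: grpl_proves_mp Pab.
Qed.

(** The equivalences for [One] and [Zero] are not among (A)-(C). For [One], both sides have grade 1,
    the constant by (B), so each implies the other by (A1). Contraposing and using bookkeeping for
    the negation of 1 gives the case of [Zero]. *)
Lemma grpl_rpl_axiom a : rpl_axiom a -> grpl_proves T (luk_one, a).
Proof.
have th := grpl_luk_theory.
have bk b : bookkeeping b -> grpl_proves T (luk_one, b).
  by move=> bkb; apply/grpl_proves_axiom/GRPLBook.
have const1 := grpl_proves_axiom (GRPLConst luk_one).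
have one := luk_id th (Var 0).
have c1_one := luk_weaken th (Const luk_one) one.
have one_c1 := luk_weaken th One const1.
case=> [b axb|b /bk //||]; first by case: th => + _; apply.
  exact/(luk_Equiv th).
have [n_z z_n] := book_Neg th bk luk_one; rewrite luk_neg1 in n_z z_n.
apply/(luk_Equiv th); split.
  exact/(luk_trans th z_n)/(luk_contra th).
by apply: (luk_trans th _ n_z); apply: (luk_contra th).
Qed.

End GRPL.

Theorem lemma4p2 (T : set graded_formula) (q : grade) (phi : formula) :
  grpl_proves T (q, phi) <->
  rpl_proves [set (Const x.1 ~> x.2)%F | x in T] (Const q ~> phi)%F.
Proof.
set S := [set _ | _ in _]; have th := rpl_luk_theory S; split.
  pose P (x : graded_formula) := rpl_proves S (Const x.1 ~> x.2)%F.
  move=> [l prl]; apply: (is_proof_ind (P := P) _ prl) => {prl}l x IHl.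
  case=> [axx|Tx|[y [z [ly lz mpx]]]|[y [ly liftx]]].
  (* Under the translation (A) and (C) follow by weakening, (B) becomes an identity and (D) is ex
     falso. *)
  - case: axx => [a axa|r|a bka|a _ _ _].
    + exact/(luk_weaken th)/rpl_proves_axiom/RPLLuk.
    + exact: (luk_id th).
    + exact/(luk_weaken th)/rpl_bookkeeping.
    + exact: rpl_Zero.
  - by apply: rpl_proves_hyp; exists x.
  - case: mpx ly lz => r s a b /IHl Pa /IHl Pab.
    exact: rpl_graded_mp Pa Pab.
  - by case: liftx ly => r s a /IHl; apply: rpl_lifting.
(* Writing [q] as its conjunction with 1 gives the goal the form of a conclusion of graded modus
   ponens. *)
move=> [l prl]; rewrite -(luk_conjq1 q).
apply: grpl_proves_mp; first exact/grpl_proves_axiom/GRPLConst.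
pose P a := grpl_proves T (luk_one, a).
apply: (is_proof_ind (P := P) _ prl) => {prl}l a IHl.
case=> [axa|[[r b] Tb <-]|[b [/IHl Pb /IHl Pba]]].
- exact: grpl_rpl_axiom.
- by rewrite /P -(luk_impqq r); apply/grpl_proves_lifting/grpl_proves_hyp.
- exact: (luk_mp (grpl_luk_theory T)) Pba Pb.
Qed.
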